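(* With respect to the convex monoidal structure $(\star,0)$ on the category $\mathbf{Set}$ of sets, the finitely supported discrete distribution monad $\mathsf D$ is a linear exponential monad; that is, $\mathsf D$ admits a symmetric opmonoidal structure with respect to $(\star,0)$ for which the lifted symmetric monoidal structure on the category of $\mathsf D$-algebras is given by finite coproducts.
   Context: The discrete distribution monad $\mathsf D=(\mathcal D,\eta,\mu)$ on $\mathbf{Set}$: $\mathcal DA$ is the set of finitely supported functions $\omega\colon A\to[0,1]$ with $\sum_a\omega(a)=1$; $\mathcal Df$ is pushforward, $(\mathcal Df)(\omega)(b)=\sum_{a\in f^{-1}(b)}\omega(a)$; $\eta_A(a)$ is the point distribution at $a$; $\mu_A(\Omega)(a)=\sum_{\omega}\Omega(\omega)\,\omega(a)$. The convex monoidal structure on $\mathbf{Set}$ has unit the empty set $0$ and tensor $A\star B=A+\bigl((0,1)\times A\times B\bigr)+B$, with $f\star g=f+\bigl((0,1)\times f\times g\bigr)+g$. The unit constraints are the evident ones $A\star0\cong A\cong0\star A$. Writing $r^*=1-r$, the associativity constraint $(A\star B)\star C\to A\star(B\star C)$ sends $(r,(s,a,b),c)$, for $r,s\in(0,1)$, to $\bigl(rs,a,(\tfrac{rs^*}{(rs)^*},b,c)\bigr)$, and is the evident identity on the remaining summands $A$, $B$, $C$, $(0,1)\times A\times B$, $(0,1)\times A\times C$, $(0,1)\times B\times C$. The symmetry $A\star B\to B\star A$ sends $(r,a,b)$ to $(r^*,b,a)$ and is the evident identity on the summands $A$ and $B$. A symmetric opmonoidal structure on a monad $\mathsf T=(T,\eta,\mu)$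 on a symmetric monoidal category $(\mathcal C,\otimes,I)$ consists of a map $\upsilon_I\colon TI\to I$ and natural maps $\upsilon_{XY}\colon T(X\otimes Y)\to TX\otimes TY$ making $T$ a symmetric opmonoidal (colax monoidal) functor and $\eta,\mu$ opmonoidal transformations. It lifts the symmetric monoidal structure of $\mathcal C$ to the category $\mathcal C^{\mathsf T}$ of Eilenberg--Moore algebras: $(X,x)\otimes(Y,y)=(X\otimes Y,(x\otimes y)\circ\upsilon_{XY})$, with unit $(I,\upsilon_I)$ and constraints those of $\mathcal C$. (Such structures correspond bijectively to symmetric monoidal structures on $\mathcal C^{\mathsf T}$ for which the forgetful functor is strict symmetric monoidal.) A linear exponential monad is a symmetric opmonoidal monad for which $(I,\upsilon_I)$ is initial in $\mathcal C^{\mathsf T}$ and, for all algebras $(X,x),(Y,y)$, the cospan $(X,x)\cong(X,x)\otimes(I,\upsilon_I)\xrightarrow{1\otimes !}(X,x)\otimes(Y,y)\xleftarrow{!\otimes 1}(I,\upsilon_I)\otimes(Y,y)\cong(Y,y)$ is a coproduct in $\mathcal C^{\mathsf T}$, where $!$ denotes the unique maps out of the initial algebra. *)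

(* Defs.v *)
From HB Require Import structures.
From mathcomp Require Import all_boot all_order all_algebra.
From mathcomp Require Import finmap mathcomp_extra boolp classical_sets functions.
From mathcomp Require Import cardinality fsbigop reals.
From mathcomp Require Import ring lra.

Set Implicit Arguments.
Unset Strict Implicit.
Unset Printing Implicit Defensive.

Import Order.TTheory GRing.Theory Num.Theory.

#[local] Obligation Tactic := idtac.

Declare Scope cat_scope.
Delimit Scope cat_scope with cat.
Local Open Scope cat_scope.

Record category := Category {
  ob :> Type;
  hom : ob -> ob -> Type;
  idm : forall a, hom a a;
  comp : forall a b c, hom b c -> hom a b -> hom a c;
  comp_idl : forall a b (f : hom a b), comp (idm b) f = f;
  comp_idr : forall a b (f : hom a b), comp f (idm a) = f;
  comp_assoc : forall a b c d (h : hom c d) (g : hom b c) (f : hom a b),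
    comp h (comp g f) = comp (comp h g) f }.

Arguments idm {C} a : rename.
Arguments comp {C a b c} g f : rename.
Notation "g \o f" := (comp g f) : cat_scope.

Record iso (C : category) (a b : C) := Iso {
  iso_hom :> hom a b;
  iso_inv : hom b a;
  iso_invK : iso_inv \o iso_hom = idm a;
  iso_homK : iso_hom \o iso_inv = idm b }.

Record functor (C D : category) := Functor {
  fob :> C -> D;
  fmap : forall a b, hom a b -> hom (fob a) (fob b);
  fmap_id : forall a, fmap (idm a) = idm (fob a);
  fmap_comp : forall a b c (g : hom b c) (f : hom a b),
    fmap (g \o f) = fmap g \o fmap f }.

Record monad (C : category) := Monad {
  mfun :> functor C C;
  eta : forall a, hom a (mfun a);
  mu : forall a, hom (mfun (mfun a)) (mfun a);
  eta_nat : forall a b (f : hom a b), fmap mfun f \o eta a = eta b \o f;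
  mu_nat : forall a b (f : hom a b),
    fmap mfun f \o mu a = mu b \o fmap mfun (fmap mfun f);
  mu_eta : forall a, mu a \o eta (mfun a) = idm (mfun a);
  mu_fmap_eta : forall a, mu a \o fmap mfun (eta a) = idm (mfun a);
  mu_mu : forall a, mu a \o mu (mfun a) = mu a \o fmap mfun (mu a) }.

Record symmetric_monoidal (C : category) := SymmetricMonoidal {
  tens : C -> C -> C;
  tmap : forall a a' b b', hom a a' -> hom b b' -> hom (tens a b) (tens a' b');
  tmap_id : forall a b, tmap (idm a) (idm b) = idm (tens a b);
  tmap_comp : forall a a' a'' b b' b'' (f' : hom a' a'') (f : hom a a')
      (g' : hom b' b'') (g : hom b b'),
    tmap (f' \o f) (g' \o g) = tmap f' g' \o tmap f g;
  tunit : C;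
  associator : forall a b c, iso (tens (tens a b) c) (tens a (tens b c));
  associator_nat : forall a a' b b' c c'
      (f : hom a a') (g : hom b b') (h : hom c c'),
    associator a' b' c' \o tmap (tmap f g) h =
    tmap f (tmap g h) \o associator a b c;
  lunitor : forall a, iso (tens tunit a) a;
  lunitor_nat : forall a b (f : hom a b),
    lunitor b \o tmap (idm tunit) f = f \o lunitor a;
  runitor : forall a, iso (tens a tunit) a;
  runitor_nat : forall a b (f : hom a b),
    runitor b \o tmap f (idm tunit) = f \o runitor a;
  symm : forall a b, hom (tens a b) (tens b a);
  symm_nat : forall a a' b b' (f : hom a a') (g : hom b b'),
    symm a' b' \o tmap f g = tmap g f \o symm a b;
  symmK : forall a b, symm b a \o symm a b = idm (tens a b);
  pentagon : forall a b c d,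
    associator a b (tens c d) \o associator (tens a b) c d =
    tmap (idm a) (associator b c d) \o associator a (tens b c) d
      \o tmap (associator a b c) (idm d);
  triangle : forall a b,
    tmap (idm a) (lunitor b) \o associator a tunit b =
    tmap (runitor a) (idm b);
  hexagon : forall a b c,
    associator b c a \o symm a (tens b c) \o associator a b c =
    tmap (idm b) (symm a c) \o associator b a c \o tmap (symm a b) (idm c) }.

Definition is_coproduct (C : category) (a b c : C) (i : hom a c) (j : hom b c) :=
  forall (d : C) (f : hom a d) (g : hom b d),
    exists! h : hom c d, h \o i = f /\ h \o j = g.

Definition cocartesian (C : category) (M : symmetric_monoidal C) : Prop :=
  exists bang : forall a : C, hom (tunit M) a,
    (forall (a : C) (f : hom (tunit M) a), f = bang a) /\
    forall a b : C,
      is_coproduct (tmap M (idm a) (bang b) \o iso_inv (runitor M a))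
                   (tmap M (bang a) (idm b) \o iso_inv (lunitor M b)).

Section Algebras.
Context {C : category} (T : monad C).

Record algebra := Algebra {
  carrier : C;
  act : hom (T carrier) carrier;
  act_eta : act \o eta T carrier = idm carrier;
  act_mu : act \o mu T carrier = act \o fmap T act }.

Record algebra_hom (x y : algebra) := AlgebraHom {
  ahom : hom (carrier x) (carrier y);
  ahomP : ahom \o act x = act y \o fmap T ahom }.

Lemma algebra_hom_eq x y (f g : algebra_hom x y) : ahom f = ahom g -> f = g.
Proof.
case: f g => [f fP] [g gP] /= fg; rewrite fg in fP *.
by congr AlgebraHom; apply: Prop_irrelevance.
Qed.

Program Definition algebra_id x : algebra_hom x x :=
  @AlgebraHom x x (idm (carrier x)) _.
Next Obligation. by move=> x; rewrite fmap_id comp_idl comp_idr. Qed.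

Program Definition algebra_comp x y z (g : algebra_hom y z)
  (f : algebra_hom x y) : algebra_hom x z := @AlgebraHom x z (ahom g \o ahom f) _.
Next Obligation.
by move=> x y z g f; rewrite fmap_comp comp_assoc -ahomP -!comp_assoc ahomP.
Qed.

Program Definition eilenberg_moore : category :=
  @Category algebra algebra_hom algebra_id algebra_comp _ _ _.
Next Obligation. by move=> x y f; apply: algebra_hom_eq; apply: comp_idl. Qed.
Next Obligation. by move=> x y f; apply: algebra_hom_eq; apply: comp_idr. Qed.
Next Obligation.
by move=> x y z t h g f; apply: algebra_hom_eq; apply: comp_assoc.
Qed.

End Algebras.

(* ups_nat to ups_symm make T a symmetric colax monoidal functor; the last four
   laws make eta and mu opmonoidal transformations *)
Record symmetric_opmonoidal (C : category) (M : symmetric_monoidal C)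
    (T : monad C) := SymmetricOpmonoidal {
  ups0 : hom (T (tunit M)) (tunit M);
  ups : forall a b, hom (T (tens M a b)) (tens M (T a) (T b));
  ups_nat : forall a a' b b' (f : hom a a') (g : hom b b'),
    ups a' b' \o fmap T (tmap M f g) =
    tmap M (fmap T f) (fmap T g) \o ups a b;
  ups_assoc : forall a b c,
    associator M (T a) (T b) (T c) \o tmap M (ups a b) (idm (T c))
      \o ups (tens M a b) c =
    tmap M (idm (T a)) (ups b c) \o ups a (tens M b c)
      \o fmap T (associator M a b c);
  ups_lunit : forall a,
    lunitor M (T a) \o tmap M ups0 (idm (T a)) \o ups (tunit M) a =
    fmap T (lunitor M a);
  ups_runit : forall a,
    runitor M (T a) \o tmap M (idm (T a)) ups0 \o ups a (tunit M) =
    fmap T (runitor M a);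
  ups_symm : forall a b,
    symm M (T a) (T b) \o ups a b = ups b a \o fmap T (symm M a b);
  ups0_eta : ups0 \o eta T (tunit M) = idm (tunit M);
  ups_eta : forall a b,
    ups a b \o eta T (tens M a b) = tmap M (eta T a) (eta T b);
  ups0_mu : ups0 \o mu T (tunit M) = ups0 \o fmap T ups0;
  ups_mu : forall a b,
    ups a b \o mu T (tens M a b) =
    tmap M (mu T a) (mu T b) \o ups (T a) (T b) \o fmap T (ups a b) }.

Section Lifting.
Context {C : category} {M : symmetric_monoidal C} {T : monad C}.
Variable U : symmetric_opmonoidal M T.

Local Notation EM := (eilenberg_moore T).

Program Definition lift_tens (x y : EM) : EM :=
  @Algebra C T (tens M (carrier x) (carrier y))
    (tmap M (act x) (act y) \o ups U (carrier x) (carrier y)) _ _.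
Next Obligation.
by move=> x y; rewrite -comp_assoc ups_eta -tmap_comp !act_eta tmap_id.
Qed.
Next Obligation.
move=> x y; rewrite -comp_assoc ups_mu !comp_assoc -tmap_comp !act_mu.
rewrite tmap_comp fmap_comp !comp_assoc; congr (_ \o _).
by rewrite -!comp_assoc ups_nat.
Qed.

Definition lift_unit : EM :=
  @Algebra C T (tunit M) (ups0 U) (ups0_eta U) (ups0_mu U).

Program Definition lift_tmap (x x' y y' : EM) (f : hom x x') (g : hom y y') :
    hom (lift_tens x y) (lift_tens x' y') :=
  @AlgebraHom C T (lift_tens x y) (lift_tens x' y') (tmap M (ahom f) (ahom g)) _.
Next Obligation.
move=> x x' y y' f g /=; rewrite comp_assoc -tmap_comp !ahomP tmap_comp.
by rewrite -!comp_assoc ups_nat.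
Qed.

Program Definition lift_iso (x y : EM) (i : iso (carrier x) (carrier y))
    (iP : i \o act x = act y \o fmap T i) : iso x y :=
  @Iso EM x y (@AlgebraHom C T x y i iP)
    (@AlgebraHom C T y x (iso_inv i) _) _ _.
Next Obligation.
move=> x y i iP.
rewrite -[LHS]comp_idr -fmap_id -(iso_homK i) fmap_comp comp_assoc.
by rewrite -(comp_assoc _ (act y)) -iP comp_assoc iso_invK comp_idl.
Qed.
Next Obligation. by move=> x y i iP; apply: algebra_hom_eq; apply: iso_invK. Qed.
Next Obligation. by move=> x y i iP; apply: algebra_hom_eq; apply: iso_homK. Qed.

Program Definition lift_associator (x y z : EM) :
    iso (lift_tens (lift_tens x y) z) (lift_tens x (lift_tens y z)) :=
  @lift_iso (lift_tens (lift_tens x y) z) (lift_tens x (lift_tens y z))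
    (associator M (carrier x) (carrier y) (carrier z)) _.
Next Obligation.
move=> x y z /=.
rewrite -{1}(comp_idr (act z)) tmap_comp !comp_assoc associator_nat.
rewrite -[in RHS](comp_idr (act x)) tmap_comp -!comp_assoc; congr (_ \o _).
by rewrite !comp_assoc ups_assoc.
Qed.

Program Definition lift_lunitor (x : EM) : iso (lift_tens lift_unit x) x :=
  @lift_iso (lift_tens lift_unit x) x (lunitor M (carrier x)) _.
Next Obligation.
move=> x /=; rewrite -(comp_idl (ups0 U)) -{1}(comp_idr (act x)) tmap_comp.
by rewrite !comp_assoc lunitor_nat -!comp_assoc -(ups_lunit U) !comp_assoc.
Qed.

Program Definition lift_runitor (x : EM) : iso (lift_tens x lift_unit) x :=
  @lift_iso (lift_tens x lift_unit) x (runitor M (carrier x)) _.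
Next Obligation.
move=> x /=; rewrite -(comp_idl (ups0 U)) -{1}(comp_idr (act x)) tmap_comp.
by rewrite !comp_assoc runitor_nat -!comp_assoc -(ups_runit U) !comp_assoc.
Qed.

Program Definition lift_symm (x y : EM) : hom (lift_tens x y) (lift_tens y x) :=
  @AlgebraHom C T (lift_tens x y) (lift_tens y x)
    (symm M (carrier x) (carrier y)) _.
Next Obligation.
by move=> x y /=; rewrite comp_assoc symm_nat -!comp_assoc ups_symm.
Qed.

Program Definition lifted_symmetric_monoidal : symmetric_monoidal EM :=
  @SymmetricMonoidal EM lift_tens lift_tmap _ _ lift_unit lift_associator _
    lift_lunitor _ lift_runitor _ lift_symm _ _ _ _ _.
Next Obligation. by move=> *; apply: algebra_hom_eq; apply: tmap_id. Qed.
Next Obligation. by move=> *; apply: algebra_hom_eq; apply: tmap_comp. Qed.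
Next Obligation. by move=> *; apply: algebra_hom_eq; apply: associator_nat. Qed.
Next Obligation. by move=> *; apply: algebra_hom_eq; apply: lunitor_nat. Qed.
Next Obligation. by move=> *; apply: algebra_hom_eq; apply: runitor_nat. Qed.
Next Obligation. by move=> *; apply: algebra_hom_eq; apply: symm_nat. Qed.
Next Obligation. by move=> *; apply: algebra_hom_eq; apply: symmK. Qed.
Next Obligation. by move=> *; apply: algebra_hom_eq; apply: pentagon. Qed.
Next Obligation. by move=> *; apply: algebra_hom_eq; apply: triangle. Qed.
Next Obligation. by move=> *; apply: algebra_hom_eq; apply: hexagon. Qed.

Definition linear_exponential : Prop := cocartesian lifted_symmetric_monoidal.

End Lifting.

Definition SET : category :=
  @Category Type (fun A B => A -> B) (fun A x => x)
    (fun A B C g f x => g (f x))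
    (fun _ _ _ => erefl) (fun _ _ _ => erefl) (fun _ _ _ _ _ _ _ => erefl).

Local Open Scope classical_set_scope.
Local Open Scope ring_scope.

Section Distributions.
Context (R : realType).

(* {classic A} is A itself with a choiceType structure, which the finitely
   supported sums require of their index type *)
Definition is_dist (A : Type) (w : A -> R) :=
  [/\ forall a, 0 <= w a <= 1, finite_set [set a | w a != 0] &
      \sum_(a \in [set: {classic A}]) w a = 1].

Record dist (A : Type) := Dist { dval :> A -> R; distP : is_dist dval }.

Lemma dist_eq A (w v : dist A) : (forall a, w a = v a) -> w = v.
Proof.
case: w v => [w wP] [v vP] /= wv.
have {}wv : w = v by apply/funext.
by rewrite wv in wP *; congr Dist; apply: Prop_irrelevance.
Qed.

Definition supported (A : Type) (f : A -> R) (s : seq {classic A}) :=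
  uniq s /\ forall a : {classic A}, f a != 0 -> a \in s.

Lemma supported_undup A (f : A -> R) (s : seq {classic A}) :
  (forall a : {classic A}, f a != 0 -> a \in s) -> supported f (undup s).
Proof.
move=> fs; split=> [|a fa]; first exact: undup_uniq.
by rewrite mem_undup; apply: fs.
Qed.

Lemma dist_supp A (w : dist A) : exists s, supported w s.
Proof.
case: (distP w) => _ /(@finite_seqP {classic A})[s sE] _.
exists (undup s); apply: supported_undup => a wa.
by have : [set a | w a != 0] a by []; rewrite sE.
Qed.

Lemma fsum_seq A (f g : A -> R) (s : seq {classic A}) : supported f s ->
  (forall a, f a = 0 -> g a = 0) ->
  \sum_(a \in [set: {classic A}]) g a = \sum_(a <- s) g a.
Proof.
move=> [us fs] fg; rewrite (fsbigTE [fset x | x in s]%fset) /=.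
  by apply: perm_big; apply: uniq_perm => // [|i]; rewrite ?fset_uniq ?inE.
move=> i; rewrite !inE /= => si; apply: fg; apply/eqP; move: si.
by apply: contraNT; apply: fs.
Qed.

Lemma dist_ge0 A (w : dist A) a : 0 <= w a.
Proof. by case: (distP w) => /(_ a)/andP[]. Qed.

Lemma dist_sum A (w : dist A) s : supported w s -> \sum_(a <- s) w a = 1.
Proof. by move=> ws; case: (distP w) => _ _; rewrite (fsum_seq ws). Qed.

Lemma is_dist_seq (A : Type) (f : A -> R) (s : seq {classic A}) :
  (forall a, 0 <= f a) -> supported f s -> \sum_(a <- s) f a = 1 -> is_dist f.
Proof.
move=> f0 fs f1; split.
- move=> a; rewrite f0 /=; have [->|/(proj2 fs) sa] := eqVneq (f a) 0.
    exact: ler01.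
  by rewrite -f1 (bigD1_seq (a : {classic A})) ?(proj1 fs)//= lerDl sumr_ge0.
- apply/(@finite_seqP {classic A}).
  exists [seq x <- s | f x != 0]; apply/seteqP; split => a /=.
    by move=> fa; rewrite mem_filter fa; apply: (proj2 fs).
  by rewrite mem_filter => /andP[].
- by rewrite (fsum_seq fs).
Qed.

Lemma sum_indicator (A : Type) (s : seq {classic A}) (g : A -> R)
    (a : {classic A}) : uniq s -> a \in s ->
  \sum_(b <- s) (a == b)%:R * g b = g a.
Proof.
move=> us sa; rewrite (bigD1_seq a) //= eqxx mul1r big1 ?addr0// => b.
by rewrite eq_sym => /negbTE->; rewrite mul0r.
Qed.

Definition expect A (w : dist A) (g : A -> R) : R :=
  \sum_(a \in [set: {classic A}]) w a * g a.

Lemma expect_seq A (w : dist A) s g : supported w s ->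
  expect w g = \sum_(a <- s) w a * g a.
Proof. by move=> ws; apply: (fsum_seq ws) => a ->; rewrite mul0r. Qed.

Lemma expect_indicator A (w : dist A) (a : {classic A}) :
  expect w (fun b : {classic A} => (b == a)%:R) = w a.
Proof.
have [s ws] := dist_supp w.
have uP : supported w (undup (a :: s)).
  apply: supported_undup => b /(proj2 ws); rewrite inE => ->.
  exact: orbT.
rewrite (expect_seq _ uP) -[RHS](@sum_indicator A (undup (a :: s)))//.
- by apply: eq_bigr => b _; rewrite mulrC eq_sym.
- exact: undup_uniq.
- by rewrite mem_undup mem_head.
Qed.

Definition map_val A B (f : A -> B) (w : A -> R) (b : B) : R :=
  \sum_(a \in (f @^-1` [set b] : set {classic A})) w a.

Lemma map_val_seq A B (f : A -> B) (w : dist A) s (b : {classic B}) :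
  supported w s ->
  map_val f w b = \sum_(a <- s) w a * ((f a : {classic B}) == b)%:R.
Proof.
move=> ws; rewrite /map_val fsbig_mkcond (@fsum_seq _ w _ s)//.
  apply: eq_bigr => a _; rewrite /patch.
  case: eqP => [fab|fab]; first by rewrite ifT ?mulr1// inE.
  by rewrite ifF ?mulr0//; apply/negbTE; rewrite notin_setE.
by move=> a wa; rewrite /patch wa; case: ifP.
Qed.

Lemma map_val_supp A B (f : A -> B) (w : dist A) s : supported w s ->
  supported (map_val f w) (undup (map (f : {classic A} -> {classic B}) s)).
Proof.
move=> ws; apply: supported_undup => b; apply: contraNT => nb.
rewrite (map_val_seq _ _ ws) big_seq big1// => a sa.
case: eqP => [fab|]; last by rewrite mulr0.
by case/negP: nb; rewrite -fab map_f.
Qed.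

Lemma map_val_expect A B (f : A -> B) (w : dist A) s g : supported w s ->
  \sum_(b <- undup (map (f : {classic A} -> {classic B}) s)) map_val f w b * g b
  = expect w (g \o f)%FUN.
Proof.
move=> ws; rewrite (expect_seq _ ws).
under eq_bigr => b _ do rewrite (map_val_seq _ _ ws) mulr_suml.
rewrite exchange_big /= big_seq [RHS]big_seq; apply: eq_bigr => a sa.
under eq_bigr => b _ do rewrite -mulrA.
by rewrite -mulr_sumr sum_indicator ?undup_uniq// mem_undup map_f.
Qed.

Lemma map_val_dist A B (f : A -> B) (w : dist A) : is_dist (map_val f w).
Proof.
have [s ws] := dist_supp w; apply: is_dist_seq (map_val_supp f ws) _.
  move=> b; rewrite (map_val_seq _ _ ws); apply: sumr_ge0 => a _.
  by rewrite mulr_ge0 ?dist_ge0 ?ler0n.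
have := map_val_expect f (fun=> 1) ws; under eq_bigr do rewrite mulr1.
move=> ->; rewrite (expect_seq _ ws) -[RHS](dist_sum ws).
by apply: eq_bigr => a _; rewrite mulr1.
Qed.

Definition dist_map A B (f : A -> B) (w : dist A) : dist B :=
  Dist (map_val_dist f w).

Lemma expect_map A B (f : A -> B) (w : dist A) g :
  expect (dist_map f w) g = expect w (g \o f)%FUN.
Proof.
have [s ws] := dist_supp w.
by rewrite -(map_val_expect f g ws) (@expect_seq _ (dist_map f w) _ g (map_val_supp f ws)).
Qed.

Lemma dist_mapE A B (f : A -> B) (w : dist A) b :
  dist_map f w b = expect w (fun a => ((f a : {classic B}) == b)%:R).
Proof.
by rewrite -[LHS]expect_indicator expect_map.
Qed.

Definition point_val A (a : A) (x : A) : R := ((x : {classic A}) == a)%:R.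

Lemma point_val_supp A (a : A) : supported (point_val a) [:: a].
Proof.
by split=> // x; rewrite inE; apply: contraNT => /negbTE; rewrite /point_val => ->.
Qed.

Lemma point_val_dist A (a : A) : is_dist (point_val a).
Proof.
apply: is_dist_seq (point_val_supp a) _ => [x|]; first exact: ler0n.
by rewrite big_seq1 /point_val eqxx.
Qed.

Definition dist_eta A (a : A) : dist A := Dist (point_val_dist a).

Lemma expect_eta A (a : A) g : expect (dist_eta a) g = g a.
Proof.
rewrite (@expect_seq _ (dist_eta a) _ g (point_val_supp a)) big_seq1 /= /point_val.
by rewrite eqxx mul1r.
Qed.

Definition join_val A (W : dist (dist A)) (a : A) : R :=
  \sum_(w \in [set: {classic (dist A)}]) W w * w a.

Lemma join_val_seq A (W : dist (dist A)) S a : supported W S ->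
  join_val W a = \sum_(w <- S) W w * (w : dist A) a.
Proof. exact: (@expect_seq _ W S (fun w : dist A => w a)). Qed.

Lemma join_supp A (W : dist (dist A)) S : supported W S ->
  exists2 s, supported (join_val W) s &
    forall w : dist A, (w : {classic (dist A)}) \in S -> supported w s.
Proof.
move=> WS; pose sup (w : dist A) := projT1 (cid (dist_supp w)).
have supP (w : dist A) : supported w (sup w) by rewrite /sup; case: cid.
have H (w : dist A) a : (w : {classic (dist A)}) \in S -> w a != 0 ->
    (a : {classic A}) \in flatten (map (sup : {classic (dist A)} -> seq {classic A}) S).
  move=> Sw /(proj2 (supP w)) wa; apply/flattenP; exists (sup w) => //.
  exact: (map_f (sup : {classic (dist A)} -> seq {classic A}) Sw).
exists (undup (flatten (map (sup : {classic (dist A)} -> seq {classic A}) S))); last first.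
  by move=> w Sw; apply: supported_undup => a; apply: H.
apply: supported_undup => a; apply: contraNT => na.
rewrite (join_val_seq _ WS) big_seq big1// => w Sw.
by have [->|/(H _ _ Sw)] := eqVneq ((w : dist A) a) 0;
  rewrite ?mulr0// (negbTE na).
Qed.

Lemma join_val_expect A (W : dist (dist A)) S s g : supported W S ->
    (forall w : dist A, (w : {classic (dist A)}) \in S -> supported w s) ->
  \sum_(a <- s) join_val W a * g a = expect W (fun w => expect w g).
Proof.
move=> WS Ss; rewrite (expect_seq _ WS).
under eq_bigr => a _ do rewrite (join_val_seq _ WS) mulr_suml.
rewrite exchange_big /= big_seq [RHS]big_seq; apply: eq_bigr => w Sw.
rewrite (expect_seq _ (Ss w Sw)) mulr_sumr.
by apply: eq_bigr => a _; rewrite mulrA.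
Qed.

Lemma join_val_dist A (W : dist (dist A)) : is_dist (join_val W).
Proof.
have [S WS] := dist_supp W; have [s js Ss] := join_supp WS.
apply: is_dist_seq js _.
  move=> a; rewrite (join_val_seq _ WS); apply: sumr_ge0 => w _.
  by rewrite mulr_ge0 ?dist_ge0.
have := join_val_expect (fun=> 1) WS Ss; under eq_bigr do rewrite mulr1.
move=> ->; rewrite (expect_seq _ WS) -[RHS](dist_sum WS) big_seq [RHS]big_seq.
apply: eq_bigr => w Sw; rewrite (expect_seq _ (Ss w Sw)).
by under eq_bigr do rewrite mulr1; rewrite (dist_sum (Ss w Sw)) mulr1.
Qed.

Definition dist_mu A (W : dist (dist A)) : dist A := Dist (join_val_dist W).

Lemma expect_mu A (W : dist (dist A)) g :
  expect (dist_mu W) g = expect W (fun w => expect w g).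
Proof.
have [S WS] := dist_supp W; have [s js Ss] := join_supp WS.
by rewrite -(join_val_expect g WS Ss) (expect_seq _ (js : supported (dist_mu W) s)).
Qed.

Lemma dist_muE A (W : dist (dist A)) a :
  dist_mu W a = expect W (fun w => w a).
Proof. by []. Qed.

Program Definition dist_functor : functor SET SET :=
  @Functor SET SET dist dist_map _ _.
Next Obligation.
move=> A; apply/funext => w; apply: dist_eq => a.
exact: etrans (dist_mapE _ _ _) (expect_indicator _ _).
Qed.
Next Obligation.
move=> A B C g f; apply/funext => w; apply: dist_eq => c.
rewrite [LHS](dist_mapE (fun x => g (f x))) [RHS](dist_mapE g (dist_map f w)).
by rewrite expect_map.
Qed.

Program Definition dist_monad : monad SET :=
  @Monad SET dist_functor dist_eta dist_mu _ _ _ _ _.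
Next Obligation.
move=> A B f; apply/funext => a; apply: dist_eq => b.
by rewrite [LHS](dist_mapE f (dist_eta a)) expect_eta eq_sym.
Qed.
Next Obligation.
move=> A B f; apply/funext => W; apply: dist_eq => b.
rewrite [LHS](dist_mapE f (dist_mu W)) expect_mu [RHS]dist_muE expect_map.
by congr expect; apply/funext => w; rewrite -(dist_mapE f w b).
Qed.
Next Obligation.
by move=> A; apply/funext => w; apply: dist_eq => a; rewrite dist_muE expect_eta.
Qed.
Next Obligation.
move=> A; apply/funext => w; apply: dist_eq => a.
rewrite dist_muE expect_map -[RHS]expect_indicator.
by congr expect; apply/funext => b; rewrite /= /point_val eq_sym.
Qed.
Next Obligation.
move=> A; apply/funext => W; apply: dist_eq => a.
by rewrite !dist_muE expect_mu expect_map.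
Qed.

End Distributions.

Section ConvexMonoidal.
Context (R : realType).

Record oint := OInt { oval : R; ointP : 0 < oval < 1 }.

Lemma oint_eq (r s : oint) : oval r = oval s -> r = s.
Proof.
case: r s => [r r01] [s s01] /= rs; rewrite rs in r01 *.
by congr OInt; apply: bool_irrelevance.
Qed.

Lemma ocompl_proof (r : oint) : 0 < 1 - oval r < 1.
Proof. by case: r => r /= /andP[? ?]; apply/andP; split; lra. Qed.

Definition ocompl (r : oint) : oint := OInt (ocompl_proof r).

Lemma omul_proof (r s : oint) : 0 < oval r * oval s < 1.
Proof.
case: r s => [r /= /andP[? ?]] [s /= /andP[? ?]]; apply/andP; split; first nra.
nra.
Qed.

Lemma omul_neq1 (r s : oint) : 1 - oval r * oval s != 0.
Proof. by have /andP[? ?] := omul_proof r s; lra. Qed.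

Definition omul (r s : oint) : oint := OInt (omul_proof r s).

Lemma oreassoc_proof (r s : oint) :
  0 < oval r * (1 - oval s) / (1 - oval r * oval s) < 1.
Proof.
have /andP[rs0 rs1] := omul_proof r s.
case: r s rs0 rs1 => [r /= /andP[? ?]] [s /= /andP[? ?]] rs0 rs1.
have d0 : 0 < 1 - r * s by lra.
by rewrite divr_gt0 ?ltr_pdivrMr //=; nra.
Qed.

Definition oreassoc (r s : oint) : oint := OInt (oreassoc_proof r s).

(* The solutions r = oadd u v, s = odiv u v of omul r s = u, oreassoc r s = v *)
Definition oadd (u v : oint) : oint := ocompl (omul (ocompl u) (ocompl v)).

Lemma odiv_proof (u v : oint) : 0 < oval u / oval (oadd u v) < 1.
Proof.
case: u v => [u /= /andP[? ?]] [v /= /andP[? ?]].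
have d0 : 0 < 1 - (1 - u) * (1 - v) by nra.
by rewrite divr_gt0 ?ltr_pdivrMr //=; nra.
Qed.

Definition odiv (u v : oint) : oint := OInt (odiv_proof u v).

Variant star (A B : Type) : Type :=
| SLeft of A
| SMid of oint & A & B
| SRight of B.
Arguments SLeft {A B}.
Arguments SMid {A B}.
Arguments SRight {A B}.

Definition star_map A A' B B' (f : A -> A') (g : B -> B') (t : star A B) :
    star A' B' :=
  match t with
  | SLeft a => SLeft (f a)
  | SMid r a b => SMid r (f a) (g b)
  | SRight b => SRight (g b)
  end.

Definition star_assoc A B C (t : star (star A B) C) : star A (star B C) :=
  match t with
  | SLeft (SLeft a) => SLeft a
  | SLeft (SMid s a b) => SMid s a (SLeft b)
  | SLeft (SRight b) => SRight (SLeft b)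
  | SMid r (SLeft a) c => SMid r a (SRight c)
  | SMid r (SMid s a b) c => SMid (omul r s) a (SMid (oreassoc r s) b c)
  | SMid r (SRight b) c => SRight (SMid r b c)
  | SRight c => SRight (SRight c)
  end.

Definition star_assoc_inv A B C (t : star A (star B C)) : star (star A B) C :=
  match t with
  | SLeft a => SLeft (SLeft a)
  | SMid s a (SLeft b) => SLeft (SMid s a b)
  | SMid u a (SMid v b c) => SMid (oadd u v) (SMid (odiv u v) a b) c
  | SMid r a (SRight c) => SMid r (SLeft a) c
  | SRight (SLeft b) => SLeft (SRight b)
  | SRight (SMid r b c) => SMid r (SRight b) c
  | SRight (SRight c) => SRight c
  end.

Definition star_lunit A (t : star void A) : A :=
  match t with
  | SLeft v | SMid _ v _ => match v with end
  | SRight a => a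
  end.

Definition star_runit A (t : star A void) : A :=
  match t with
  | SLeft a => a
  | SMid _ _ v | SRight v => match v with end
  end.

Definition star_symm A B (t : star A B) : star B A :=
  match t with
  | SLeft a => SRight a
  | SMid r a b => SMid (ocompl r) b a
  | SRight b => SLeft b
  end.

Lemma star_assocK A B C : cancel (@star_assoc A B C) (@star_assoc_inv A B C).
Proof.
case=> [[a|s a b|b]|r [a|s a b|b] c|c] //=.
have /andP[? ?] := omul_proof r s.
have r0 : oval r != 0 by case: (r) => ? /= /andP[? ?]; lra.
have e : oadd (omul r s) (oreassoc r s) = r.
  by apply: oint_eq => /=; field; lra.
have e' : odiv (omul r s) (oreassoc r s) = s.
  apply: oint_eq; rewrite -[LHS]/(oval (omul r s) / oval (oadd _ _)) e /=.
  by field.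
by rewrite e e'.
Qed.

Lemma star_assoc_invK A B C : cancel (@star_assoc_inv A B C) (@star_assoc A B C).
Proof.
case=> [a|u a [b|v b c|c]|[b|r b c|c]] //=.
have d0 : oval (oadd u v) != 0 by case: (oadd u v) => ? /= /andP[? ?]; lra.
have u1 : 1 - oval u != 0 by case: (u) => ? /= /andP[? ?]; lra.
have e : omul (oadd u v) (odiv u v) = u.
  apply: oint_eq; rewrite -[LHS]/(oval (oadd u v) * (oval u / oval (oadd u v))).
  by field.
have e' : oreassoc (oadd u v) (odiv u v) = v.
  apply: oint_eq; rewrite /= in d0 *; field; rewrite d0 /= ?u1 //.
by rewrite e e'.
Qed.

Program Definition star_associator (A B C : SET) :
    @iso SET (star (star A B) C) (star A (star B C)) :=
  @Iso SET (star (star A B) C) (star A (star B C))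
    (@star_assoc A B C) (@star_assoc_inv A B C) _ _.
Next Obligation. by move=> A B C; apply/funext/star_assocK. Qed.
Next Obligation. by move=> A B C; apply/funext/star_assoc_invK. Qed.

Program Definition star_lunitor (A : SET) : @iso SET (star void A) A :=
  @Iso SET (star void A) A (@star_lunit A) SRight _ _.
Next Obligation. by move=> A; apply/funext => -[[]|? []|]. Qed.
Next Obligation. by []. Qed.

Program Definition star_runitor (A : SET) : @iso SET (star A void) A :=
  @Iso SET (star A void) A (@star_runit A) SLeft _ _.
Next Obligation. by move=> A; apply/funext => -[|? ? []|[]]. Qed.
Next Obligation. by []. Qed.

Program Definition convex_monoidal : symmetric_monoidal SET :=
  @SymmetricMonoidal SET star star_map _ _ void star_associator _
    star_lunitor _ star_runitor _ star_symm _ _ _ _ _.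
Next Obligation. by move=> A B; apply/funext => -[]. Qed.
Next Obligation. by move=> *; apply/funext => -[]. Qed.
Next Obligation.
by move=> *; apply/funext => -[[a|s a b|b]|r [a|s a b|b] c|c].
Qed.
Next Obligation. by move=> *; apply/funext => -[[]|? []|]. Qed.
Next Obligation. by move=> *; apply/funext => -[|? ? []|[]]. Qed.
Next Obligation. by move=> *; apply/funext => -[]. Qed.
Next Obligation.
move=> A B; apply/funext => -[] //= r a b.
by congr SMid; apply: oint_eq => /=; ring.
Qed.
Next Obligation.
move=> A B C D; apply/funext.
case=> [[[a|s a b|b]|r [a|s a b|b] c|c]|q [[a|s a b|b]|r [a|s a b|b] c|c] d|d] //=.
congr (SMid _ _ (SMid _ _ (SMid _ _ _))).
- by apply: oint_eq => /=; ring.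
- by apply: oint_eq => /=; field; rewrite !omul_neq1 (omul_neq1 q (omul r s)).
- apply: oint_eq => /=; field.
  have -> : 1 - oval q * (oval r * oval s) - oval q * (oval r * (1 - oval s)) =
    1 - oval q * oval r by ring.
  by rewrite !omul_neq1 (omul_neq1 q (omul r s)).
Qed.
Next Obligation. by move=> A B; apply/funext => -[[a|s a []|[]]|r [a|s a []|[]] c|c]. Qed.
Next Obligation.
move=> A B C; apply/funext => -[[a|s a b|b]|r [a|s a b|b] c|c] //=.
congr (SMid _ _ (SMid _ _ _)); apply: oint_eq => /=; field.
  exact: omul_neq1.
by rewrite omul_neq1 (omul_neq1 r (ocompl s)).
Qed.

End ConvexMonoidal.

(* Main.v *)
(* The free algebras D A and D B have coproduct D (A + B), and D (A + B) is also
   D A * D B for the convex tensor *: a distribution on A + B is determined by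
   its mass on A and its conditional distributions on A and on B.  The
   opmonoidal map D (A * B) -> D A * D B is the extension of the map
   A * B -> D (A + B) sending (r, a, b) to r a + (1 - r) b.  Elements z of
   D A * D B are separated by the numbers
     <f, g> z = r E_u f + (1 - r) E_v g    (z = (r, u, v)),
   which are the integrals of f + g : A + B -> R, and the opmonoidal map is
   characterised by <f, g> (ups w) = E_w <f, g>; every coherence law follows by
   comparing such numbers.  In the lifted tensor the element (r, a, b) is the
   convex combination r a + (1 - r) b, which forces the copairing. *)
Require Import Defs.
From mathcomp Require Import all_boot all_order all_algebra.
From mathcomp Require Import boolp reals.
From mathcomp Require Import ring lra.

Set Implicit Arguments.
Unset Strict Implicit.
Unset Printing Implicit Defensive.

Import Order.TTheory GRing.Theory Num.Theory.
Local Open Scope ring_scope.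

Arguments SLeft {R A B}.
Arguments SMid {R A B}.
Arguments SRight {R A B}.

(** * Expectations and binary convex combinations of distributions *)

Section Expectation.
Context {R : realType} (A : Type).
Implicit Types (w : dist R A) (f g : A -> R).

Lemma expectD w f g : expect w (fun a => f a + g a) = expect w f + expect w g.
Proof.
have [s ws] := dist_supp w; rewrite !(expect_seq _ ws) -big_split /=.
by apply: eq_bigr => a _; rewrite mulrDr.
Qed.

Lemma expect_cst w (c : R) : expect w (fun=> c) = c.
Proof.
have [s ws] := dist_supp w.
by rewrite (expect_seq _ ws) -mulr_suml (dist_sum ws) mul1r.
Qed.

Lemma expect_ge0 w f : (forall a, 0 <= f a) -> 0 <= expect w f.
Proof.
have [s ws] := dist_supp w; rewrite (expect_seq _ ws) => f0.
by apply: sumr_ge0 => a _; rewrite mulr_ge0 ?dist_ge0.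
Qed.

Lemma expect_inj (w v : dist R A) : (forall f, expect w f = expect v f) -> w = v.
Proof.
by move=> wv; apply: dist_eq => a; rewrite -[LHS]expect_indicator wv expect_indicator.
Qed.

(** A vanishing sum of nonnegative terms vanishes termwise, so [f], and hence [g], is zero on the
    support of [w]. This disposes of a side of [star R A B] that carries no mass. *)
Lemma expect_eq0 w f g : (forall a, 0 <= f a) -> (forall a, f a = 0 -> g a = 0) ->
  expect w f = 0 -> expect w g = 0.
Proof.
have [s ws] := dist_supp w; rewrite !(expect_seq _ ws) => f0 fg /eqP.
rewrite psumr_eq0 => [/allP wf0|a _]; last by rewrite mulr_ge0 ?dist_ge0.
rewrite big_seq big1// => a /wf0; rewrite /= mulf_eq0 => /orP[/eqP->|/eqP/fg->].
  by rewrite mul0r.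
by rewrite mulr0.
Qed.

Lemma mix_dist (r : oint R) (u v : dist R A) :
  is_dist (fun a => oval r * u a + (1 - oval r) * v a).
Proof.
have /andP[r0 r1] := ointP r.
have [s us] := dist_supp u; have [t vt] := dist_supp v.
have uu : supported u (undup (s ++ t)).
  by apply: supported_undup => a /(proj2 us); rewrite mem_cat => ->.
have vv : supported v (undup (s ++ t)).
  by apply: supported_undup => a /(proj2 vt); rewrite mem_cat orbC => ->.
apply: (@is_dist_seq _ _ _ (undup (s ++ t))).
- by move=> a; rewrite addr_ge0 ?mulr_ge0 ?dist_ge0 ?subr_ge0// ltW.
- apply: supported_undup => a; have [u0|/(proj2 us)] := eqVneq (u a) 0.
    have [v0|/(proj2 vt)] := eqVneq (v a) 0; last by rewrite mem_cat orbC => ->.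
    by rewrite u0 v0 !mulr0 addr0 eqxx.
  by rewrite mem_cat => ->.
- rewrite big_split /= -!mulr_sumr (dist_sum uu) (dist_sum vv); ring.
Qed.

Definition mix r u v : dist R A := Dist (mix_dist r u v).

Lemma expect_mix r u v f :
  expect (mix r u v) f = oval r * expect u f + (1 - oval r) * expect v f.
Proof.
have [s us] := dist_supp u; have [t vt] := dist_supp v; have [q mq] := dist_supp (mix r u v).
(* One list supporting all three distributions lets the sums be compared term by term. *)
pose l := undup (s ++ t ++ q).
have uu : supported u l.
  by apply: supported_undup => a /(proj2 us); rewrite !mem_cat => ->.
have vv : supported v l.
  by apply: supported_undup => a /(proj2 vt); rewrite !mem_cat => ->; rewrite orbT.
have mm : supported (mix r u v) l.
  by apply: supported_undup => a /(proj2 mq); rewrite !mem_cat => ->; rewrite !orbT.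
rewrite (expect_seq _ uu) (expect_seq _ vv) (expect_seq _ mm) !mulr_sumr -big_split /=.
by apply: eq_bigr => a _; ring.
Qed.

End Expectation.

(** * Real-valued pairings that separate the points of a convex tensor *)

Section Pairing.
Context {R : realType}.

Definition pairing A B (f : A -> R) (g : B -> R) (t : star R A B) : R :=
  match t with
  | SLeft a => f a
  | SMid r a b => oval r * f a + (1 - oval r) * g b
  | SRight b => g b
  end.

Lemma pairing_map A A' B B' (p : A -> A') (q : B -> B') (f : A' -> R) (g : B' -> R) t :
  pairing f g (star_map p q t) = pairing (fun a => f (p a)) (fun b => g (q b)) t.
Proof. by case: t. Qed.

Lemma pairing_symm A B (f : A -> R) (g : B -> R) t :
  pairing g f (star_symm t) = pairing f g t.
Proof. by case: t => //= r a b; ring. Qed.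

Lemma pairing_assoc A B C (f : A -> R) (g : B -> R) (h : C -> R) t :
  pairing f (pairing g h) (star_assoc t) = pairing (pairing f g) h t.
Proof.
case: t => [[]|r [a|s a b|b] c|] //=.
by field; exact: omul_neq1.
Qed.

(** The two constants are demanded so that the notion passes from [X] and [Y] to [star R X Y], and
    therefore to iterated tensors. *)
Definition separating X (F : (X -> R) -> Prop) :=
  [/\ F (fun=> 1), F (fun=> 0) &
      forall x y, (forall f, F f -> f x = f y) -> x = y].

Definition expectations A (e : dist R A -> R) := exists f, e = expect (A:=A)^~ f.

Definition pairings X Y (F : (X -> R) -> Prop) (G : (Y -> R) -> Prop)
    (e : star R X Y -> R) :=
  exists f g, [/\ F f, G g & e = pairing f g].

Lemma expectations_separating A : separating (@expectations A).
Proof.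
split.
- by exists (fun=> 1); apply/funext => w; rewrite expect_cst.
- by exists (fun=> 0); apply/funext => w; rewrite expect_cst.
- by move=> w v wv; apply: expect_inj => f; apply: (wv (expect (A:=A)^~ f)); exists f.
Qed.

Lemma pairings_separating X Y (F : (X -> R) -> Prop) (G : (Y -> R) -> Prop) :
  separating F -> separating G -> separating (pairings F G).
Proof.
move=> [F1 F0 Finj] [G1 G0 Ginj]; split.
- exists (fun=> 1), (fun=> 1); split=> //; apply/funext => -[]//= *; ring.
- exists (fun=> 0), (fun=> 0); split=> //; apply/funext => -[]//= *; ring.
move=> z z' zz'.
have H f g : F f -> G g -> pairing f g z = pairing f g z'.
  by move=> Ff Gg; apply: zz'; exists f, g.
(* On the three summands <1, 0> takes the values 1, r and 0 with 0 < r < 1, so it decides both the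
   summand and the weight. Then <f, 0> and <0, g> give the components, after cancelling a nonzero
   weight in the middle summand. *)
have {zz'} := H _ _ F1 G0.
have {}Hl f : F f -> _ := fun Ff => H f _ Ff G0.
have {H}Hr g : G g -> _ := fun Gg => H _ g F0 Gg.
case: z z' Hl Hr => [a|r a b|b] [a'|r' a' b'|b'] /= Hl Hr;
  rewrite ?mulr0 ?mulr1 ?addr0.
- by move=> _; congr SLeft; apply: Finj.
- by have /andP[] := ointP r' => ? ? ?; exfalso; lra.
- by move=> ?; exfalso; lra.
- by have /andP[] := ointP r => ? ? ?; exfalso; lra.
- move/oint_eq => rr'; rewrite -{r'}rr' in Hl Hr *.
  have /andP[r0 r1] := ointP r.
  have -> : a = a'.
    apply: Finj => f /Hl; rewrite !mulr0 !addr0; apply: mulfI; exact: lt0r_neq0.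
  have -> // : b = b'.
  apply: Ginj => g /Hr; rewrite !mulr0 !add0r; apply: mulfI; apply: lt0r_neq0.
  by rewrite subr_gt0.
- by have /andP[] := ointP r => ? ? ?; exfalso; lra.
- by move=> ?; exfalso; lra.
- by have /andP[] := ointP r' => ? ? ?; exfalso; lra.
- by move=> _; congr SRight; apply: Ginj.
Qed.

Lemma star_dist_eq A B (z z' : star R (dist R A) (dist R B)) :
  (forall f g, pairing (expect (A:=A)^~ f) (expect (A:=B)^~ g) z =
               pairing (expect (A:=A)^~ f) (expect (A:=B)^~ g) z') -> z = z'.
Proof.
have [_ _ inj] := pairings_separating (@expectations_separating A) (@expectations_separating B).
by move=> H; apply: inj => _ [_ [_ [[f ->] [g ->] ->]]]; apply: H.
Qed.

Lemma star3_dist_eq A B C (z z' : star R (dist R A) (star R (dist R B) (dist R C))) :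
  (forall f g h,
     pairing (expect (A:=A)^~ f) (pairing (expect (A:=B)^~ g) (expect (A:=C)^~ h)) z =
     pairing (expect (A:=A)^~ f) (pairing (expect (A:=B)^~ g) (expect (A:=C)^~ h)) z') ->
  z = z'.
Proof.
have [_ _ inj] := pairings_separating (@expectations_separating A)
  (pairings_separating (@expectations_separating B) (@expectations_separating C)).
move=> H; apply: inj => _ [_ [_ [[f ->] [_ [_ [[g ->] [h ->] ->]]] ->]]]; exact: H.
Qed.

End Pairing.

(** * The opmonoidal structure maps and their coherence laws *)

Section Ups.
Context {R : realType}.

Definition left_part A B (t : {classic (star R A B)}) : option {classic A} :=
  match t : star R A B with SLeft a | SMid _ a _ => Some a | SRight _ => None end.

Lemma pairing_ge0 A B (f : A -> R) (g : B -> R) t :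
  (forall a, 0 <= f a) -> (forall b, 0 <= g b) -> 0 <= pairing f g t.
Proof.
move=> f0 g0; case: t => //= r a b; have /andP[r0 r1] := ointP r.
by rewrite addr_ge0 ?mulr_ge0 ?subr_ge0// ltW.
Qed.

(** The witness is the conditional distribution on [A]: the mass that [w] sends to each point of
    [A], counting (r, a, b) with weight r, divided by the total mass [p] of the left side. *)
Lemma left_marginal A B (w : dist R (star R A B)) :
  let p := expect w (pairing (fun=> 1) (fun=> 0)) in p != 0 ->
  exists u : dist R A, forall f, expect w (pairing f (fun=> 0)) = p * expect u f.
Proof.
move=> p p0; have pge0 : 0 <= p.
  by apply: expect_ge0 => t; apply: pairing_ge0 => *; rewrite ?ler01.
have [s ws] := dist_supp w.
(* Only the finitely many left coordinates met in the support of [w] can receive mass. *)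
pose l := undup (pmap (@left_part A B) s).
have mem_l t : t \in s -> forall a, left_part t = Some a -> a \in l.
  by move=> st a ta; rewrite mem_undup mem_pmap -ta map_f.
pose ind (a : {classic A}) (x : {classic A}) : R := (x == a)%:R.
pose v (a : A) := expect w (pairing (ind a) (fun=> 0)).
have sum_v f : \sum_(a <- l) v a * f a = expect w (pairing f (fun=> 0)).
  under eq_bigr => a _ do rewrite /v (expect_seq _ ws) mulr_suml.
  rewrite (expect_seq _ ws) exchange_big /= big_seq [RHS]big_seq.
  apply: eq_bigr => t /mem_l {}mem_l; under eq_bigr => a _ do rewrite -mulrA.
  rewrite -mulr_sumr; congr (_ * _).
  case: t mem_l => [a|r a b|b] /= mem_l.
  - by rewrite (@sum_indicator R A) ?undup_uniq ?mem_l.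
  - under eq_bigr => x _ do rewrite mulr0 addr0 -mulrA.
    by rewrite -mulr_sumr (@sum_indicator R A) ?undup_uniq ?mem_l// mulr0 addr0.
  - by rewrite big1// => a _; rewrite mul0r.
have v_supp (a : {classic A}) : v a != 0 -> a \in l.
  apply: contraNT => al; rewrite /v (expect_seq _ ws) big_seq big1// => t /mem_l {}mem_l.
  have ax x : left_part t = Some x -> ind a x = 0.
    by rewrite /ind => /mem_l xl; case: eqP => // xa; rewrite -xa xl in al.
  by case: t ax {mem_l} => [x|r x b|b] /= ax; rewrite ?(ax x)// ?mulr0 ?addr0 ?mulr0.
have ud : is_dist (fun a => v a / p).
  apply: (@is_dist_seq _ _ _ l).
  - move=> a; rewrite divr_ge0//; apply: expect_ge0 => t.
    by apply: pairing_ge0 => *; rewrite ?ler0n.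
  - split=> [|a]; first exact: undup_uniq.
    by move=> va; apply: v_supp; apply: contraNneq va => ->; rewrite mul0r.
  - rewrite -mulr_suml; under eq_bigr do rewrite -[v _]mulr1.
    by rewrite sum_v divff.
exists (Dist ud) => f; rewrite (@expect_seq _ _ _ l) /=.
  rewrite mulr_sumr -sum_v; apply: eq_bigr => a _; field; exact: p0.
split=> [|a]; first exact: undup_uniq.
by move=> va; apply: v_supp; apply: contraNneq va => /= ->; rewrite mul0r.
Qed.

(** The weight of [z] is the mass [p] of the left side, and its components are the two conditional
    distributions; additivity of the expectation splits the integral of [pairing f g]
    accordingly. *)
Lemma ups_exists A B (w : dist R (star R A B)) :
  exists z : star R (dist R A) (dist R B), forall f g,
    pairing (expect (A:=A)^~ f) (expect (A:=B)^~ g) z = expect w (pairing f g).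
Proof.
pose p := expect w (pairing (fun=> 1) (fun=> 0)).
pose q := expect w (pairing (fun=> 0) (fun=> 1)).
have split_w f g : expect w (pairing f g) =
    expect w (pairing f (fun=> 0)) + expect w (pairing (fun=> 0) g).
  by rewrite -expectD; congr expect; apply/funext => -[]//= *; ring.
have pq : p + q = 1.
  rewrite -split_w -[RHS](expect_cst w).
  by congr expect; apply/funext => -[]//= *; ring.
have p_ge0 : 0 <= p.
  by apply: expect_ge0 => t; apply: pairing_ge0 => *; rewrite ?ler01.
have q_ge0 : 0 <= q.
  by apply: expect_ge0 => t; apply: pairing_ge0 => *; rewrite ?ler01.
have p0 f : p = 0 -> expect w (pairing f (fun=> 0)) = 0.
  apply: expect_eq0 => t.
    by apply: pairing_ge0 => *; rewrite ?ler01.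
  case: t => //= [a|r a b]; rewrite ?mulr0 ?mulr1 ?addr0; first by lra.
  by move=> ->; rewrite mul0r.
have q0 g : q = 0 -> expect w (pairing (fun=> 0) g) = 0.
  apply: expect_eq0 => t.
    by apply: pairing_ge0 => *; rewrite ?ler01.
  case: t => //= [r a b|b]; rewrite ?mulr0 ?mulr1 ?add0r; last by lra.
  by move=> ->; rewrite mul0r.
have left_w : p != 0 -> exists u : dist R A,
    forall f, expect w (pairing f (fun=> 0)) = p * expect u f.
  exact: left_marginal.
have right_w : q != 0 -> exists v : dist R B,
    forall g, expect w (pairing (fun=> 0) g) = q * expect v g.
  (* The symmetry exchanges the sides, so the right conditional distribution is the left one of the
     transported distribution. *)
  have symm_w g : expect (dist_map (@star_symm R A B) w) (pairing g (fun=> 0)) =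
      expect w (pairing (fun=> 0) g).
    by rewrite expect_map; congr expect; apply/funext => t; apply: pairing_symm.
  move=> nq0; have := @left_marginal _ _ (dist_map (@star_symm R A B) w).
  by rewrite /= symm_w => /(_ nq0)[v vE]; exists v => g; rewrite -symm_w.
(* A side of mass zero has no conditional distribution; [z] then lies in the outer summand of the
   other side. *)
have [pE|np0] := eqVneq p 0.
  have qE : q = 1 by lra.
  have [|v vE] := right_w; first by rewrite qE oner_eq0.
  by exists (SRight v) => f g /=; rewrite split_w p0// vE qE mul1r add0r.
have [u uE] := left_w np0.
have [qE|nq0] := eqVneq q 0.
  have pE : p = 1 by lra.
  by exists (SLeft u) => f g /=; rewrite split_w q0// uE pE mul1r addr0.
have [v vE] := right_w nq0.
have p01 : 0 < p < 1.
  have : 0 < p by rewrite lt0r np0.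
  have : 0 < q by rewrite lt0r nq0.
  by move=> ? ?; apply/andP; split; lra.
exists (SMid (OInt p01) u v) => f g /=; rewrite split_w uE vE.
by have -> : q = 1 - p by lra.
Qed.

(** The use of choice is harmless: by [star_dist_eq] there is only one witness. *)
Definition star_split A B (w : dist R (star R A B)) : star R (dist R A) (dist R B) :=
  projT1 (cid (ups_exists w)).

Lemma star_splitE A B (w : dist R (star R A B)) f g :
  pairing (expect (A:=A)^~ f) (expect (A:=B)^~ g) (star_split w) =
  expect w (pairing f g).
Proof. by rewrite /star_split; case: cid. Qed.

(** On the empty set the constants 1 and 0 are the same function, yet their expectations differ. *)
Lemma no_dist_void (w : dist R void) : False.
Proof.
have := expect_cst w 1; rewrite -[X in _ = X]addr0 => w1.
have : expect w (fun=> 1) = expect w (fun=> 0) by congr expect; apply/funext => -[].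
by rewrite !expect_cst => /eqP; rewrite oner_eq0.
Qed.

Definition void_of_dist (w : dist R void) : void := False_rect void (no_dist_void w).

Lemma split_nat A A' B B' (f : A -> A') (g : B -> B') (w : dist R (star R A B)) :
  star_split (dist_map (star_map f g) w) =
  star_map (dist_map f) (dist_map g) (star_split w).
Proof.
apply: star_dist_eq => p q; rewrite star_splitE expect_map pairing_map.
under [X in pairing X _ _]funext => u do rewrite expect_map.
under [X in pairing _ X _]funext => u do rewrite expect_map.
by rewrite star_splitE; congr expect; apply/funext => t; apply: pairing_map.
Qed.

(** Since [star_assoc] preserves nested pairings, both sides pair with f, g, h to the integral of
    [pairing (pairing f g) h] against [w]. *)
Lemma split_assoc A B C (w : dist R (star R (star R A B) C)) :
  star_assoc (star_map (@star_split A B) id (star_split w)) =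
  star_map id (@star_split B C) (star_split (dist_map (@star_assoc R A B C) w)).
Proof.
apply: star3_dist_eq => f g h; rewrite pairing_assoc !pairing_map.
under [X in pairing X _ _]funext => u do rewrite star_splitE.
under [X in _ = pairing _ X _]funext => u do rewrite star_splitE.
rewrite !star_splitE expect_map; congr expect; apply/funext => t.
by rewrite /= pairing_assoc.
Qed.

Lemma split_lunit A (w : dist R (star R void A)) :
  star_lunit (star_map void_of_dist id (star_split w)) = dist_map (@star_lunit R A) w.
Proof.
apply: expect_inj => f; rewrite expect_map.
transitivity (expect w (pairing (fun=> 0) f)).
  (* Every summand but the right one would contain a distribution on [void]. *)
  by rewrite -star_splitE; case: (star_split w) => // [u|? u ?]; case: (no_dist_void u).
by congr expect; apply/funext => -[[]|? []|].
Qed.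

Lemma split_runit A (w : dist R (star R A void)) :
  star_runit (star_map id void_of_dist (star_split w)) = dist_map (@star_runit R A) w.
Proof.
apply: expect_inj => f; rewrite expect_map.
transitivity (expect w (pairing f (fun=> 0))).
  by rewrite -star_splitE; case: (star_split w) => // [? ? u|u]; case: (no_dist_void u).
by congr expect; apply/funext => -[|? ? []|[]].
Qed.

Lemma split_symm A B (w : dist R (star R A B)) :
  star_symm (star_split w) = star_split (dist_map (@star_symm R A B) w).
Proof.
apply: star_dist_eq => f g; rewrite pairing_symm !star_splitE expect_map.
by congr expect; apply/funext => t; rewrite /= pairing_symm.
Qed.

Lemma split_eta A B (t : star R A B) :
  star_split (dist_eta R t) = star_map (@dist_eta R A) (@dist_eta R B) t.
Proof.
apply: star_dist_eq => f g; rewrite star_splitE expect_eta pairing_map.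
by case: t => /= *; rewrite ?expect_eta.
Qed.

Lemma split_mu A B (W : dist R (dist R (star R A B))) :
  star_split (dist_mu W) =
  star_map (@dist_mu R A) (@dist_mu R B) (star_split (dist_map (@star_split A B) W)).
Proof.
apply: star_dist_eq => f g; rewrite star_splitE expect_mu pairing_map.
under [X in pairing X _ _]funext => u do rewrite expect_mu.
under [X in pairing _ X _]funext => u do rewrite expect_mu.
rewrite star_splitE expect_map; congr expect; apply/funext => w.
by rewrite /= star_splitE.
Qed.

Program Definition convex_opmonoidal :
    symmetric_opmonoidal (convex_monoidal R) (dist_monad R) :=
  @SymmetricOpmonoidal SET (convex_monoidal R) (dist_monad R)
    void_of_dist star_split _ _ _ _ _ _ _ _ _.
Next Obligation. by move=> *; apply/funext => w; apply: split_nat. Qed.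
Next Obligation. by move=> *; apply/funext => w; apply: split_assoc. Qed.
Next Obligation. by move=> *; apply/funext => w; apply: split_lunit. Qed.
Next Obligation. by move=> *; apply/funext => w; apply: split_runit. Qed.
Next Obligation. by move=> *; apply/funext => w; apply: split_symm. Qed.
Next Obligation. by apply/funext => -[]. Qed.
Next Obligation. by move=> *; apply/funext => w; apply: split_eta. Qed.
Next Obligation. by apply/funext => W; case: (no_dist_void (dist_mu W)). Qed.
Next Obligation. by move=> *; apply/funext => w; apply: split_mu. Qed.

End Ups.

(** * Copairing into a free algebra *)

Section Glue.
Context {R : realType}.

Definition glue A B D (p : A -> dist R D) (q : B -> dist R D) (t : star R A B) : dist R D :=
  match t with
  | SLeft a => p a
  | SMid r a b => mix r (p a) (q b)
  | SRight b => q b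
  end.

Lemma expect_glue A B D (p : A -> dist R D) (q : B -> dist R D) t f :
  expect (glue p q t) f =
  pairing (fun a => expect (p a) f) (fun b => expect (q b) f) t.
Proof. by case: t => //= r a b; rewrite expect_mix. Qed.

(** Both sides integrate [p] to the [w]-integral of the pairing of p after f with p after g. This
    trades [star_split] for the monad multiplication, to which the algebra laws apply. *)
Lemma glue_split A B D (f : A -> D) (g : B -> D) w :
  glue (dist_map f) (dist_map g) (star_split w) =
  dist_mu (dist_map (glue (fun a => dist_eta R (f a)) (fun b => dist_eta R (g b))) w).
Proof.
apply: expect_inj => p; rewrite expect_glue expect_mu expect_map.
under [X in pairing X _ _]funext => u do rewrite expect_map.
under [X in pairing _ X _]funext => u do rewrite expect_map.
rewrite star_splitE; congr expect; apply/funext => t.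
by rewrite /= expect_glue; case: t => /= *; rewrite ?expect_eta.
Qed.

End Glue.

(** * Existence and uniqueness of copairings of algebra maps *)

Section Coproduct.
Context {R : realType} {A B D : Type}.

Definition copair (act : dist R D -> D) (f : A -> D) (g : B -> D) (t : star R A B) : D :=
  act (glue (fun a => dist_eta R (f a)) (fun b => dist_eta R (g b)) t).

(** The homomorphism laws of [f] and [g] turn the left side into [aD] of a [glue]; [glue_split] and
    the multiplication law of [aD] then give the right side. *)
Lemma copair_hom (aA : dist R A -> A) (aB : dist R B -> B) (aD : dist R D -> D)
    (f : A -> D) (g : B -> D) :
  (forall d, aD (dist_eta R d) = d) ->
  (forall W, aD (dist_mu W) = aD (dist_map aD W)) ->
  (forall u, f (aA u) = aD (dist_map f u)) ->
  (forall v, g (aB v) = aD (dist_map g v)) ->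
  forall w, copair aD f g (star_map aA aB (star_split w)) =
            aD (dist_map (copair aD f g) w).
Proof.
move=> aD_eta aD_mu fP gP w.
transitivity (aD (glue (dist_map f) (dist_map g) (star_split w))).
  rewrite /copair; case: (star_split w) => [u|r u v|v] /=; rewrite ?aD_eta ?fP ?gP//.
  (* The mixture of values of [aD] comes from a mixture of point distributions on [dist R D], where
     the multiplication law can be used. *)
  transitivity (aD (dist_map aD
      (mix r (dist_eta R (dist_map f u)) (dist_eta R (dist_map g v))))).
    congr aD; apply: expect_inj => p.
    by rewrite expect_map !expect_mix !expect_eta.
  rewrite -aD_mu; congr aD; apply: expect_inj => p.
  by rewrite expect_mu !expect_mix !expect_eta.
rewrite glue_split aD_mu; congr aD; apply: expect_inj => p.
by rewrite !expect_map.
Qed.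

Lemma split_mix (r : oint R) (a : A) (b : B) :
  star_split (mix r (dist_eta R (SLeft a)) (dist_eta R (SRight b))) =
  SMid r (dist_eta R a) (dist_eta R b).
Proof.
apply: star_dist_eq => f g.
by rewrite star_splitE expect_mix /= !expect_eta.
Qed.

(** By [split_mix] and the unit laws, (r, a, b) is the value of the lifted action at a mixture of
    [SLeft a] and [SRight b], so a homomorphism is determined on it by its values on the outer
    summands. *)
Lemma copair_uniq (aA : dist R A -> A) (aB : dist R B -> B) (aD : dist R D -> D)
    (h : star R A B -> D) :
  (forall a, aA (dist_eta R a) = a) -> (forall b, aB (dist_eta R b) = b) ->
  (forall d, aD (dist_eta R d) = d) ->
  (forall w, h (star_map aA aB (star_split w)) = aD (dist_map h w)) ->
  h = copair aD (fun a => h (SLeft a)) (fun b => h (SRight b)).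
Proof.
move=> aA_eta aB_eta aD_eta hP; apply/funext => -[a|r a b|b];
  rewrite /copair /= ?aD_eta//.
have := hP (mix r (dist_eta R (SLeft a)) (dist_eta R (SRight b))).
rewrite split_mix /= aA_eta aB_eta => ->; congr aD; apply: expect_inj => p.
by rewrite expect_map !expect_mix !expect_eta.
Qed.

End Coproduct.

(** * The initial algebra and binary coproducts in the lifted structure *)

Section LinearExponential.
Context {R : realType}.

Local Notation T := (dist_monad R).
Local Notation U := (@convex_opmonoidal R).

Definition void_alg_hom (x : algebra T) : algebra_hom (lift_unit U) x :=
  @AlgebraHom SET T (lift_unit U) x (fun v : void => match v with end)
    (funext (fun w => False_rect _ (no_dist_void w))).

Definition copair_alg_hom (x y z : algebra T) (f : algebra_hom x z)
    (g : algebra_hom y z) : algebra_hom (lift_tens U x y) z :=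
  @AlgebraHom SET T (lift_tens U x y) z (copair (act z) (ahom f) (ahom g))
    (funext (copair_hom (fun d => congr1 (@^~ d) (act_eta z)) (fun W => congr1 (@^~ W) (act_mu z))
      (fun u => congr1 (@^~ u) (ahomP f)) (fun v => congr1 (@^~ v) (ahomP g)))).

End LinearExponential.

Theorem proposition30 (R : realType) :
  exists U : symmetric_opmonoidal (convex_monoidal R) (dist_monad R),
    linear_exponential U.
Proof.
exists convex_opmonoidal, void_alg_hom; split.
  by move=> x f; apply: algebra_hom_eq; apply/funext => -[].
have algE (x : algebra (dist_monad R)) a : act x (dist_eta R a) = a.
  exact: (congr1 (@^~ a) (act_eta x)).
have homE (x y : algebra (dist_monad R)) (f : algebra_hom x y) u :
    ahom f (act x u) = act y (dist_map (ahom f) u).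
  exact: (congr1 (@^~ u) (ahomP f)).
move=> x y z f g; exists (copair_alg_hom f g); split.
  by split; apply: algebra_hom_eq; apply/funext => a; apply: algE.
(* The coproduct injections compute to [SLeft] and [SRight], so replacing [f] and [g] by the
   composites with [h] leaves an instance of [copair_uniq]. *)
move=> h [<- <-]; apply: algebra_hom_eq; apply: esym.
exact: (copair_uniq (algE x) (algE y) (algE z) (homE _ _ h)).
Qed.
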